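(* Let $X$ be a charming (Tychonoff) space with a Lindelöf $\Sigma$ kernel $Y$. If $D\subseteq Y$ is nonempty, countable and closed discrete in $Y$, then $C=\overline{D}^{\,X}$ (the closure of $D$ in $X$) is a closed charming subspace of $X$, and $D$ is a countable Lindelöf $\Sigma$ kernel of $C$ that is open and dense in $C$. In particular, $C\setminus D$ is Lindelöf $\Sigma$ and $C$ is a $D$-space.
   Context: All spaces are Tychonoff (completely regular and Hausdorff); subsets carry the subspace topology. A space $X$ is a $D$-space if for every neighborhood assignment $\varphi$ (a map assigning to each $x\in X$ an open set $\varphi(x)\ni x$) there is a closed discrete set $E\subseteq X$ with $X=\bigcup_{d\in E}\varphi(d)$. A space $Z$ is Lindelöf $\Sigma$ if there are a second countable Tychonoff space $M$ and a map $\Phi$ from $M$ to the nonempty compact subsets of $Z$ that is upper semicontinuous (for each open $U\subseteq Z$, $\{m\in M:\Phi(m)\subseteq U\}$ is open in $M$) with $Z=\bigcup_{m\in M}\Phi(m)$. A space $X$ is charming if it has a Lindelöf $\Sigma$ subspace $Y$ such that for every open $U\subseteq X$ with $Y\subseteq U$, the subspace $X\setminus U$ is Lindelöf $\Sigma$; such a $Y$ is called a Lindelöf $\Sigma$ kernel of $X$. (In the claim, the set named $D$ is unrelated to the letter in the term ''$D$-space''.) *)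

(* Defs.v *)
From mathcomp Require Import all_boot all_order all_algebra.
From mathcomp Require Import all_classical all_reals all_analysis.

Set Implicit Arguments.
Unset Strict Implicit.
Unset Printing Implicit Defensive.

Local Open Scope classical_set_scope.

(* Subspaces are the types [set_type A] for [A : set X], which carry the
   initial topology of the inclusion [set_val : set_type A -> X]. *)

(* Spaces are Tychonoff by convention.  The definitions below do not repeat
   this for the space they are about: Tychonoff is hereditary, so it is enough
   to assume it of the ambient space. *)
Definition tychonoff_space (T : topologicalType) : Prop :=
  completely_regular_space T /\ hausdorff_space T.

Definition closed_discrete (T : topologicalType) (E : set T) : Prop :=
  closed E /\ isolated E = E.

Definition D_space (T : topologicalType) : Prop :=
  forall phi : T -> set T, (forall x, open_nbhs x (phi x)) ->
  exists2 E : set T, closed_discrete E & \bigcup_(d in E) phi d = [set: T].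

Definition upper_semicontinuous (M Z : topologicalType)
    (Phi : M -> set Z) : Prop :=
  forall U : set Z, open U -> open [set m | Phi m `<=` U].

(* [M] may be empty, so the empty space is Lindelof Sigma. *)
Definition lindelof_sigma (Z : topologicalType) : Prop :=
  exists (M : topologicalType) (Phi : M -> set Z),
    [/\ @second_countable M, tychonoff_space M,
        forall m, Phi m !=set0 /\ compact (Phi m),
        upper_semicontinuous Phi &
        \bigcup_m Phi m = [set: Z]].

Definition lindelof_sigma_kernel (X : topologicalType) (Y : set X) : Prop :=
  lindelof_sigma (set_type Y) /\
  forall U : set X, open U -> Y `<=` U -> lindelof_sigma (set_type (~` U)).

Definition charming (X : topologicalType) : Prop :=
  exists Y : set X, lindelof_sigma_kernel Y.

(* The trace of [B] on the subspace [A], as a set of points of that subspace. *)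
Definition trace (X : topologicalType) (A B : set X) : set (set_type A) :=
  set_val @^-1` B.
Arguments trace {X} A B.

(* Main.v *)
Require Import Defs.
From mathcomp Require Import all_boot all_order all_algebra.
From mathcomp Require Import all_classical all_reals all_analysis.

(* Since [D] is discrete it is open in [C], and since it is closed in [Y] we
   have [C `&` Y = D]; so a closed subset of [C] missing [D] is closed in
   [X] and misses [Y], hence is Lindelof Sigma by the kernel property. That
   gives everything except the D-space property, which reduces to [C `\` D]
   by adding to a closed discrete set the isolated points left uncovered.

   A T1 Lindelof Sigma space is a D-space by a greedy argument. A countable
   base of [M] yields countably many sets [F] such that every open set
   containing some [Phi m] contains an [F] containing [Phi m]. List them
   with infinite repetition; at step [j], if finitely many points outside
   the open set covered so far suffice to complete the cover of [F j],
   choose such points. Compactness of [Phi m] minus the final union shows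
   that everything gets covered, and each stage's open set meets only the
   finitely many points chosen before it. *)

Set Implicit Arguments.
Unset Strict Implicit.
Unset Printing Implicit Defensive.

Local Open Scope classical_set_scope.

(** * Neighborhoods in subspaces, closed discrete sets, compactness *)

Lemma nbhs_set_typeP (X : topologicalType) (A : set X) (x : set_type A)
    (V : set (set_type A)) :
  nbhs x V <-> exists W : set X,
    [/\ open W, W (set_val x) & trace A W `<=` V].
Proof.
split.
  by case=> _ [[W oW <-] Wx WV]; exists W.
by case=> W [oW Wx WV]; exists (trace A W); split=> //; exists W.
Qed.

(** At a point of [E] the local condition is isolation; at any other point it says that the
    complement of [E] is a neighborhood, which is closedness. *)
Lemma closed_discreteP (T : topologicalType) (E : set T) :
  closed_discrete E <->
  forall x, exists2 V, nbhs x V & V `&` E `<=` [set x].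
Proof.
split=> [[clE isoE] x | locE].
  have [Ex|nEx] := pselect (E x).
    move: Ex; rewrite -{1}isoE => -[_ [V xV VE]].
    by exists V => // y; rewrite VE.
  exists (~` E); last by move=> y [].
  by apply: open_nbhs_nbhs; split => //; exact: closed_openC.
split.
  move=> x clEx; have [V xV VE] := locE x.
  by have [y [Ey Vy]] := clEx _ xV; rewrite -(VE y (conj Vy Ey)).
apply/seteqP; split=> [x [/set_mem //]|x Ex].
split; first exact/mem_set.
have [V xV VE] := locE x; exists V => //.
apply/seteqP; split => // _ ->; split => //; exact: nbhs_singleton.
Qed.

Lemma locally_finite_closed_discrete (T : topologicalType) (E : set T) :
  accessible_space T ->
  (forall x : T, exists2 U, nbhs x U & finite_set (U `&` E)) ->
  closed_discrete E.
Proof.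
move=> T1 lf; apply/closed_discreteP => x; have [U xU finUE] := lf x.
pose A := (U `&` E) `\ x.
have clA : closed A.
  by move/accessible_finite_set_closed: T1; apply; exact: finite_setD.
exists (U `&` ~` A).
  apply: filterI => //; apply: open_nbhs_nbhs; split; first exact: closed_openC.
  by case=> _; apply.
by move=> y [[Uy nAy] Ey]; apply: contrapT => yx; apply: nAy.
Qed.

Lemma accessible_set_type (X : topologicalType) (A : set X) :
  accessible_space X -> accessible_space (set_type A).
Proof.
move=> T1 x y; rewrite -(inj_eq val_inj) => /T1 -[W [oW xW yW]].
exists (trace A W); split; first by exists W.
  by apply/mem_set; exact: set_mem xW.
by apply/mem_set; exact: set_mem yW.
Qed.

(* [j + 1 = 2 ^ n * odd]: index [j] lists the element coded by [n]. *)
Lemma countable_enum_repeated (T : choiceType) (x0 : T) (A : set T) :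
  countable A ->
  exists s : nat -> T, forall a k, A a -> exists2 j, (k <= j)%N & s j = a.
Proof.
move=> /countable_injP[f injf].
exists (fun j => xget x0 [set a | A a /\ f a = logn 2 j.+1]) => a k Aa.
(* The odd factor keeps the exponent of 2 equal to [f a] and makes [m] exceed [k]. *)
pose m := (2 ^ f a * k.*2.+1)%N.
have m0 : (0 < m)%N by rewrite /m muln_gt0 expn_gt0.
exists m.-1.
  rewrite -ltnS prednK // /m.
  apply: leq_trans (leq_pmull _ _); last by rewrite expn_gt0.
  by rewrite ltnS -addnn leq_addr.
rewrite prednK //.
have -> : logn 2 m = f a.
  rewrite lognM ?expn_gt0 // pfactorK // logn_coprime ?addn0 //.
  by rewrite coprime2n /= odd_double.
apply: xget_unique => // b [Ab fb].
by apply: injf => //; exact/mem_set.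
Qed.

(** If no finite subfamily covers [K], the sets left uncovered generate a proper filter on [K]. A
    cluster point lies in some open [f i], yet removing [f i] gives a member of the filter. *)
Lemma compact_finite_subcover (T : topologicalType) (I : choiceType)
    (K : set T) (J : set I) (f : I -> set T) :
  compact K -> (forall i, J i -> open (f i)) -> K `<=` \bigcup_(i in J) f i ->
  exists S : set I, [/\ finite_set S, S `<=` J & K `<=` \bigcup_(i in S) f i].
Proof.
move=> cptK oJ KJ; apply: contrapT => noS.
pose G := [set S : set I | finite_set S /\ S `<=` J].
pose F := filter_from G (fun S => K `\` \bigcup_(i in S) f i).
have FF : ProperFilter F.
  apply: filter_from_proper; last first.
    move=> S [finS SJ]; apply: contrapT => /nonemptyPn KS; apply: noS.
    exists S; split => // x Kx; apply: contrapT => nx.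
    by have : set0 x by rewrite -KS.
  apply: filter_from_filter; first by exists set0; split => //.
  move=> S S' [finS SJ] [finS' SJ']; exists (S `|` S').
    by split; [rewrite finite_setU | rewrite subUset].
  rewrite bigcup_setU => x [Kx nx].
  by split; split => // ?; apply: nx; [left|right].
have [|x [Kx clx]] := cptK F FF.
  by exists set0; [split | move=> x []].
have [i Ji fix_] := KJ x Kx.
have [] := clx (K `\` \bigcup_(j in [set i]) f j) (f i).
- exists [set i] => //; split; first exact: finite_set1.
  by move=> _ ->.
- by apply: open_nbhs_nbhs; split => //; exact: oJ.
- by move=> y [[_ ny] fy]; apply: ny; exists i.
Qed.

(** * Lindelof Sigma spaces and D-spaces *)

Lemma lindelof_sigma_image (Z Z' : topologicalType) (f : Z -> Z') :
  continuous f -> (forall z', exists z, f z = z') ->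
  lindelof_sigma Z -> lindelof_sigma Z'.
Proof.
move=> cf surj [M [Phi [scM tychM cptPhi uscPhi covPhi]]].
exists M, (fun m => f @` Phi m); split => //.
- move=> m; have [Pm0 cptm] := cptPhi m; split; first exact: image_nonempty.
  by apply: continuous_compact => //; exact: continuous_subspaceT.
- move=> U oU; have oV : open (f @^-1` U) by move/continuousP: cf; exact.
  have := uscPhi _ oV; congr open; apply/seteqP; split=> m PU.
    by move=> _ [z Pz <-]; exact: PU.
  by move=> z Pz; apply: PU; exists z.
- apply/seteqP; split => // z' _; have [z <-] := surj z'.
  have : [set: Z] z by [].
  by rewrite -covPhi => -[m _ Pz]; exists m => //; exists z.
Qed.

Lemma lindelof_sigma_countable (Z : topologicalType) :
  countable [set: Z] -> lindelof_sigma Z.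
Proof.
move=> cZ; pose M := discrete_topology Z.
exists M, (fun z : M => [set (z : Z)]); split.
- exists (set1 @` [set: M]); first exact: sub_countable (card_image_le _ _) _.
  split=> [U _|z V zV]; first exact: discrete_open.
  exists [set z]; first by split => //; exists z.
  by move=> _ ->; exact: nbhs_singleton.
- split; last exact: discrete_hausdorff.
  (* In the discrete uniformity the diagonal is an entourage, and it separates [z] from any set that
     omits [z]. *)
  move=> z V _ nVz; exists (Uniform.class M), diagonal; split => //.
    by move=> _ [x _ <-].
    apply/seteqP; split=> // -[x y] [[/= -> Vy] /= yx].
    by apply: nVz; rewrite [z]yx.
  by move=> x W.
- by move=> m; split; [exists m | exact: compact_set1].
- by move=> U _; exact: discrete_open.
- by apply/seteqP; split => // z _; exists z.
Qed.

Lemma lindelof_sigma_D_space (Z : topologicalType) :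
  accessible_space Z -> lindelof_sigma Z -> D_space Z.
Proof.
move=> T1 [M [Phi [[B cB [Bopen basisB]] _ cptPhi uscPhi covPhi]]] phi phiP.
have [s sP] := countable_enum_repeated set0 cB.
pose F j := \bigcup_(m in s j) Phi m.
pose U (S : set Z) := \bigcup_(d in S) phi d.
pose good j (S : set Z) := [set A : set Z |
  [/\ finite_set A, A `&` U S = set0 & F j `<=` U S `|` U A]].
(* The default [set0] means that a stage with no suitable finite set adds no points. *)
pose next j S := xget set0 (good j S).
pose E := fix E j := if j is i.+1 then E i `|` next i (E i) else set0.
have next_fin j S : finite_set (next j S).
  by rewrite /next; case: xgetP => // A _ [].
have next_disj j S : next j S `&` U S = set0.
  by rewrite /next; case: xgetP => [A _ []|_] //; rewrite set0I.
have E_mono i j : (i <= j)%N -> E i `<=` E j.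
  elim: j => [|j IH]; first by rewrite leqn0 => /eqP ->.
  rewrite leq_eqVlt => /predU1P[->//|]; rewrite ltnS => /IH.
  by move=> Eij x /Eij; left.
have E_fin j : finite_set (E j).
  by elim: j => [|j IH] /=; [exact: finite_set0 | rewrite finite_setU].
have U_open S : open (U S).
  by apply: bigcup_open => d _; have [] := phiP d.
(* Points added at stage [k] or later avoid [U (E k)], so this open set meets the final union only
   inside the finite set [E k]. *)
have E_disj j k x : E j x -> U (E k) x -> E k x.
  elim: j => // j IH /= [/IH //|nx] Ukx.
  have [kj|jk] := leqP k j; last by apply: (E_mono _ _ jk); right.
  have : set0 x.
    rewrite -(next_disj j (E j)); split => //.
    by have [d /(E_mono _ _ kj) Ed dx] := Ukx; exists d.
  by [].
have cov x : exists k, U (E k) x.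
  have : [set: Z] x by [].
  rewrite -covPhi => -[m _ mx].
  apply: contrapT => /forallNP nUx.
  pose V := \bigcup_k U (E k).
  have [_ cptm] := cptPhi m.
  have V_open : open V by apply: bigcup_open.
  have cptK : compact (Phi m `&` ~` V).
    by apply: compact_closedI => //; exact: open_closedC.
  (* The points of [A] lie outside [V], hence outside every [U (E j)]: [A] stays an admissible
     choice at all stages. *)
  have [//|y my|A [finA AK KA]] :=
      compact_finite_subcover (J := Phi m `&` ~` V) (f := phi) cptK.
  - by move=> y _; have [] := phiP y.
  - by exists y => //; have [] := phiP y.
  (* A second use of compactness: the sets [U (E k)] increase, so a single [k] suffices together
     with [A]. *)
  have [//|y my|N [finN _ mN]] := compact_finite_subcover (J := [set: nat])
      (f := fun k => U (E k) `|` U A) cptm.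
  - by move=> k _; exact: openU.
  - have [[k _ Vy]|nVy] := pselect (V y); first by exists k => //; left.
    by exists 0%N => //; right; exact: KA.
  have [k Nk] : exists k, forall i, N i -> (i <= k)%N.
    have /finite_seqP[r ->] := finN; exists (\max_(i <- r) i)%N => i /= Ni.
    exact: leq_bigmax_seq.
  have mk : Phi m `<=` U (E k) `|` U A.
    move=> y /mN [i /Nk ik [[d Ed dy]|]]; last by right.
    by left; exists d => //; exact: E_mono Ed.
  have : nbhs m [set m' | Phi m' `<=` U (E k) `|` U A].
    apply: open_nbhs_nbhs; split => //; apply: uscPhi; exact: openU.
  move=> /basisB[W [BW Wm] WU].
  (* The repetition in the list lets [W] be met again at a stage [j] no earlier than [k], where [A]
     shows that the choice is not the default. *)
  have [j kj sjW] := sP W k BW.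
  have Fj : F j `<=` U (E k) `|` U A.
    by rewrite /F sjW => y [m' /WU]; exact.
  have ne : good j (E j) (next j (E j)).
    apply: (@xgetPex _ set0 (good j (E j))); exists A; split => //.
      rewrite -subset0 => y [/AK [_ nVy] Uy]; apply: nVy.
      by exists j.
    move=> y /Fj [[d /(E_mono _ _ kj) Ed dy]|]; [left|by right].
    by exists d.
  apply: (nUx j.+1); have [_ _ /(_ x)] := ne.
  case; first by exists m => //; rewrite sjW.
    by move=> [d Ed dx]; exists d => //; left.
  by move=> [d Ed dx]; exists d => //; right.
exists (\bigcup_k E k); last first.
  apply/seteqP; split => // x _; have [k [d Ed dx]] := cov x.
  by exists d => //; exists k.
apply: locally_finite_closed_discrete => // x; have [k Ux] := cov x.
exists (U (E k)); first exact: open_nbhs_nbhs.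
by apply: sub_finite_set (E_fin k) => y [Uy [j _ Ey]]; exact: E_disj Ey Uy.
Qed.

Lemma D_space_add_isolated (T : topologicalType) (L : set T) :
  (forall x, ~ L x -> nbhs x [set x]) ->
  D_space (set_type L) -> D_space T.
Proof.
move=> isoL DL phi phiP.
have [x|E /closed_discreteP locE covE] :=
    DL (fun x => trace L (phi (set_val x))).
  have [oV Vx] := phiP (set_val x).
  by split => //; exists (phi (set_val x)).
pose V := \bigcup_(d in E) phi (set_val d).
exists (set_val @` E `|` (~` L `&` ~` V)); last first.
  apply/seteqP; split => // x _.
  have [[d Ed dx]|nVx] := pselect (V x).
    by exists (set_val d) => //; left; exists d.
  exists x; last by have [] := phiP x.
  right; split => // Lx; apply: nVx.
  have : [set: set_type L] (SigSub (mem_set Lx)) by [].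
  by rewrite -covE => -[d Ed dx]; exists d.
apply/closed_discreteP => x.
have [Lx|nLx] := pselect (L x); last first.
  by exists [set x]; [exact: isoL | move=> y []].
pose x' : set_type L := SigSub (mem_set Lx).
have [W xW WE] := locE x'.
move/nbhs_set_typeP: xW => [W' [oW' Wx W'W]].
have V_open : open V by apply: bigcup_open => d _; have [] := phiP (set_val d).
(* [V] contains [L] and misses all the added points, while [W'] leaves at most [x] from the image of
   [E]. *)
exists (W' `&` V).
  apply: open_nbhs_nbhs; split; first exact: openI.
  split => //; have : [set: set_type L] x' by [].
  by rewrite -covE => -[d Ed dx]; exists d.
move=> y [[Wy Vy] [[e Ee ey]|[_ nVy]]]; last by case: (nVy Vy).
suff -> : y = set_val x' by [].
rewrite -ey; congr set_val; apply: WE; split => //; apply: W'W.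
by rewrite /trace /= ey.
Qed.

(** * Subspaces of subspaces, and the closure of a discrete set *)

(** [B] as a subspace of [X] and as a subspace of [A] are different types; the identity on points is
    a continuous surjection from the first to the second. *)
Lemma lindelof_sigma_trace (X : topologicalType) (A B : set X) :
  B `<=` A -> lindelof_sigma (set_type B) ->
  lindelof_sigma (set_type (trace A B)).
Proof.
move=> BA; pose g (x : set_type B) : set_type A :=
  SigSub (mem_set (BA _ (set_valP x))).
have gB x : trace A B (g x) by exact: (set_valP x).
pose f (x : set_type B) : set_type (trace A B) := SigSub (mem_set (gB x)).
apply: (@lindelof_sigma_image _ _ f).
  apply: (@continuous_comp_initial _ _ _ (set_val : trace A B -> A) f).
  apply: (@continuous_comp_initial _ _ _ (set_val : A -> X) g).
  exact: (@initial_continuous _ _ (set_val : B -> X)).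
move=> z; have Bz : B (set_val (set_val z)) by exact: (set_valP z).
by exists (SigSub (mem_set Bz)); apply/val_inj/val_inj.
Qed.

(** Were another point of the closure in [W], deleting [d] from [W] would leave a neighborhood of it
    that misses [D]. *)
Lemma discrete_isolated_closure (X : topologicalType) (D : set X) (d : X) :
  accessible_space X -> isolated D d ->
  exists W, [/\ open W, W d & W `&` closure D `<=` [set d]].
Proof.
move=> T1 [Dd [V]]; rewrite nbhsE => -[W [oW Wd] WV VD].
exists W; split => // y [Wy cly]; apply: contrapT => yd.
have [|z [Dz [Wz zd]]] := cly (W `&` ~` [set d]).
  apply: open_nbhs_nbhs; split => //; apply: openI => //.
  by apply: closed_openC; exact: accessible_closed_set1.
by apply: zd; rewrite -VD; split => //; exact: WV.
Qed.

Lemma countable_trace (X : topologicalType) (A D : set X) :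
  countable D -> countable (trace A D).
Proof.
move=> /countable_injP[h injh]; apply/countable_injP; exists (h \o set_val).
by move=> x y /set_mem Dx /set_mem Dy /injh xy; apply/val_inj/xy; exact/mem_set.
Qed.

(** Neighborhoods in [Y] are traces of those in [X], so a point of [Y] adherent to [D] in [X] is
    already adherent in [Y]. *)
Lemma closed_discrete_trace_closure (X : topologicalType) (Y D : set X) :
  closed_discrete (trace Y D) -> D `<=` Y -> closure D `&` Y `<=` D.
Proof.
move=> [clD _] DY y [cly Yy].
apply: (clD (SigSub (mem_set Yy))) => V /nbhs_set_typeP[W [oW Wy WV]].
have [|d [Dd Wd]] := cly W; first exact: open_nbhs_nbhs.
by exists (SigSub (mem_set (DY _ Dd))); split => //; exact: WV.
Qed.

Lemma closed_discrete_trace_isolated (X : topologicalType) (Y D : set X) :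
  closed_discrete (trace Y D) -> D `<=` Y -> D `<=` isolated D.
Proof.
move=> [_ isoD] DY d Dd; split; first exact/mem_set.
have : isolated (trace Y D) (SigSub (mem_set (DY _ Dd))) by rewrite isoD.
move=> [_ [V /nbhs_set_typeP[W [oW Wd WV]] VD]].
exists W; first exact: open_nbhs_nbhs.
apply/seteqP; split => [x [Wx Dx]|_ ->//].
pose x' : set_type Y := SigSub (mem_set (DY _ Dx)).
have : (V `&` trace Y D) x' by split => //; exact: WV.
by rewrite VD => /(congr1 set_val).
Qed.

Theorem proposition3p28 (X : topologicalType) (Y D : set X) :
  tychonoff_space X ->
  lindelof_sigma_kernel Y ->
  D `<=` Y -> D !=set0 -> countable D -> closed_discrete (trace Y D) ->
  let C := closure D in
  [/\ closed C /\ charming (set_type C),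
      [/\ countable (trace C D), lindelof_sigma_kernel (trace C D),
          open (trace C D) & dense (trace C D)],
      lindelof_sigma (set_type (C `\` D)) &
      D_space (set_type C)].
Proof.
move=> [_ /hausdorff_accessible T1] [_ kerY] DY _ cD cdD C.
have clC : closed C by exact: closed_closure.
have CYD : C `&` Y `<=` D by exact: closed_discrete_trace_closure.
have isoD d : D d -> exists W, [/\ open W, W d & W `&` C `<=` [set d]].
  move=> Dd; apply: discrete_isolated_closure => //.
  exact: (closed_discrete_trace_isolated cdD DY Dd).
have isoT (x : C) : trace C D x -> nbhs x [set x].
  move=> /isoD [W [oW Wx WC]]; apply/nbhs_set_typeP; exists W; split => // y Wy.
  by apply/val_inj; apply: WC; split => //; exact: set_valP.
have openD : open (trace C D).
  rewrite openE => x Dx; rewrite /interior.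
  by apply: filterS (isoT x Dx) => _ ->.
have lindelofX (F : set X) : closed F -> F `<=` C `\` D ->
    lindelof_sigma (set_type F).
  move=> clF FCD; rewrite -[F]setCK; apply: kerY; first exact: closed_openC.
  by move=> y Yy /FCD[Cy]; apply; apply: CYD.
have kerD : lindelof_sigma_kernel (trace C D).
  split.
    apply: lindelof_sigma_countable.
    have -> : [set: trace C D] = trace _ (trace C D).
      by apply/seteqP; split=> // x _; exact: set_valP.
    by do 2 apply: countable_trace.
  move=> _ [W oW <-] DW.
  have -> : ~` (set_val @^-1` W) = trace C (C `&` ~` W).
    by apply/seteqP; split=> [x nWx|x []//]; split => //; exact: set_valP.
  apply: lindelof_sigma_trace; first by move=> ? [].
  apply: lindelofX; first by apply: closedI => //; exact: open_closedC.
  move=> x [Cx nWx]; split => // Dx; apply: nWx.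
  exact: (DW (SigSub (mem_set Cx))).
split.
- by split=> //; exists (trace C D).
- split=> //; first exact: countable_trace.
  move=> V [x Vx] [W oW WV].
  have [|d [Dd Wd]] := set_valP x W.
    by apply: open_nbhs_nbhs; split => //; rewrite -WV in Vx.
  have Cd : C d by exact: subset_closure.
  by exists (SigSub (mem_set Cd)); rewrite -WV.
(* Writing the open set [trace C D] as the trace of an open [W] of [X] shows that the difference is
   closed in [X]. *)
- apply: lindelofX => //; have [W oW WD] := openD.
  rewrite (_ : C `\` D = C `&` ~` W).
    by apply: closedI => //; exact: open_closedC.
  apply/seteqP; split=> x [Cx nx]; split => //; apply: contra_not nx => Ax.
    have : trace C W (SigSub (mem_set Cx)) by [].
    by rewrite /trace WD.
  have : trace C D (SigSub (mem_set Cx)) by [].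
  by rewrite -WD.
- apply: (@D_space_add_isolated _ (~` trace C D)).
  + by move=> x /contrapT; exact: isoT.
  + apply: lindelof_sigma_D_space; first by do 2 apply: accessible_set_type.
    (* The kernel property is applied to the open set [trace C D] itself. *)
    by have [_] := kerD; apply.
Qed.
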